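(* Let $s\ge 1$ and consider an $s$-stage explicit Runge-Kutta method with coefficients $a_{ij}, b_i$ and $\alpha$-form coefficients $\alpha_{ij},\beta_i$. Suppose that it is a 2N-storage method with 2N-storage coefficients $A_i,B_i$ such that $A_i\neq 0$ for $i=2,\dots,s$. Then for every $j=1,\dots,s-2$ $$\frac{\alpha_{j+2,j}}{\alpha_{j+2,j+1}}=\frac{\alpha_{j+3,j}}{\alpha_{j+3,j+1}}=\dots=\frac{\alpha_{s,j}}{\alpha_{s,j+1}}=\frac{\beta_j}{\beta_{j+1}},$$ that is, $\alpha_{i,j}/\alpha_{i,j+1}=\beta_j/\beta_{j+1}$ for all $i=j+2,\dots,s$.
   Context: An $s$-stage explicit Runge-Kutta method ($a$-form) has real coefficients $a_{ij}$ ($i,j=1,\dots,s$, $a_{ij}=0$ for $i\le j$), $b_i$ and nodes $c_i=\sum_{j=1}^{i-1}a_{ij}$ (so $c_1=0$). With step size $h$ it computes $y_i=y_0+h\sum_{j=1}^{i-1}a_{ij}k_j$, $k_i=f(t+c_ih,y_i)$, $i=1,\dots,s$, and $y_{s+1}=y_0+h\sum_{i=1}^s b_ik_i$. $\alpha$-form: the same method written as $y_i=y_{i-1}+h\sum_{j=1}^{i-1}\alpha_{ij}k_j$, $i=1,\dots,s+1$, with $\alpha_{s+1,j}$ denoted $\beta_j$; equivalently $\alpha_{ij}=a_{ij}-a_{i-1,j}$ for $2\le i\le s$, $1\le j<i$, and $\beta_i=b_i-a_{s,i}$ for $1\le i\le s$ (with $a_{ij}=0$ for $i\le j$). 2N-storage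 method ($A$-form): the method is a 2N-storage method with coefficients $A_1=0,A_2,\dots,A_s$ and $B_1,\dots,B_s$, all $B_i\ne0$, if its stages coincide (identically, as formal linear combinations of $y_0$ and $k_1,\dots,k_s$, treated as independent symbols) with those produced by $y_1=y_0$, $\Delta y_2=hk_1$, $\Delta y_i=A_{i-1}\Delta y_{i-1}+hk_{i-1}$ for $i=3,\dots,s+1$, and $y_i=y_{i-1}+B_{i-1}\Delta y_i$ for $i=2,\dots,s+1$. *)

(* Defs.v *)
From HB Require Import structures.
From mathcomp Require Import all_boot all_order all_algebra.
From mathcomp Require Import reals.

Set Implicit Arguments.
Unset Strict Implicit.
Unset Printing Implicit Defensive.

Import Order.TTheory GRing.Theory Num.Theory.
Local Open Scope ring_scope.

(* Stages and coefficients are numbered from 1, as is customary for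
   Runge-Kutta methods; the families below are indexed by nat and only their
   values on 1, ..., s are meaningful.  The nodes c_i, being the row sums of a,
   are not separate data. *)
Record explicit_rk (R : realType) (s : nat) := ExplicitRK {
  rk_a : nat -> nat -> R;
  rk_b : nat -> R;
  rk_explicit : forall i j : nat, (1 <= i)%N -> (i <= j)%N -> (j <= s)%N ->
    rk_a i j = 0
}.

Section Methods.
Variables (R : realType) (s : nat).

(* The stage y_i, i = 1, ..., s + 1, where y_(s+1) is the computed step. *)
Definition rk_stage (m : explicit_rk R s) (V : lmodType R) (h : R) (y0 : V)
    (k : nat -> V) (i : nat) : V :=
  if i == s.+1 then y0 + h *: \sum_(1 <= j < s.+1) rk_b m j *: k j
  else y0 + h *: \sum_(1 <= j < i) rk_a m i j *: k j.

(* Coefficients of the form y_i = y_(i-1) + h * \sum_(j < i) alpha_ij k_j: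
   rk_alpha for 2 <= i <= s, and rk_beta for i = s + 1. *)
Definition rk_alpha (m : explicit_rk R s) (i j : nat) : R :=
  rk_a m i j - rk_a m i.-1 j.

Definition rk_beta (m : explicit_rk R s) (j : nat) : R :=
  rk_b m j - rk_a m s j.

(* The increments start at index 2; the values at 0 and 1 are junk. *)
Fixpoint twoN_delta (A : nat -> R) (V : lmodType R) (h : R) (k : nat -> V)
    (i : nat) : V :=
  match i with
  | (_.+2 as i').+1 => A i' *: twoN_delta A h k i' + h *: k i'
  | 2 => h *: k 1%N
  | _ => 0
  end.

(* The stages start at index 1; the value at 0 is the initial value y0. *)
Fixpoint twoN_stage (A B : nat -> R) (V : lmodType R) (h : R) (y0 : V)
    (k : nat -> V) (i : nat) : V :=
  match i with
  | (_.+1 as i').+1 => twoN_stage A B h y0 k i' + B i' *: twoN_delta A h k i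
  | _ => y0
  end.

(* Formal linear combinations of y_0, k_1, ..., k_s are the vectors of
   R^(s+1); the canonical basis vector of index 0 stands for y_0, and the one
   of index j, 1 <= j <= s, for k_j. *)
Definition symbol (j : nat) : 'rV[R]_s.+1 := delta_mx 0 (inord j).

Definition is_twoN_storage (m : explicit_rk R s) (A B : nat -> R) : Prop :=
  [/\ A 1%N = 0,
      forall i : nat, (1 <= i <= s)%N -> B i != 0 &
      forall (h : R) (i : nat), (1 <= i <= s.+1)%N ->
        rk_stage m h (symbol 0) symbol i
        = twoN_stage A B h (symbol 0) symbol i].

End Methods.

(* Main.v *)
(** The increment satisfies [Delta y_(i+1) = A_i Delta y_i + h k_i], so for
    [i >= j + 2] the coefficient of [k_j] in it (with [h = 1]) is
    [A_(j+1) * ... * A_(i-1)], which is [A_(j+1)] times the coefficient of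
    [k_(j+1)].  As [alpha_ij], and [beta_j] for [i = s + 1], is [B_(i-1)] times
    the coefficient of [k_j] in [Delta y_i], all the ratios are [A_(j+1)]. *)

Require Import Defs.
From HB Require Import structures.
From mathcomp Require Import all_boot all_order all_algebra.
From mathcomp Require Import reals.

Import Order.TTheory GRing.Theory Num.Theory.
Local Open Scope ring_scope.

Lemma symbolE (R : realType) (s l j : nat) : (l <= s)%N -> (j <= s)%N ->
  symbol R s l 0 (inord j) = (l == j)%:R.
Proof.
by move=> ls js; rewrite mxE eqxx /= -val_eqE /= !inordK // eq_sym.
Qed.

Lemma coord_sum_symbol (R : realType) (s n j : nat) (c : nat -> R) :
  (n <= s.+1)%N -> (1 <= j <= s)%N ->
  (\sum_(1 <= l < n) c l *: symbol R s l) 0 (inord j)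
  = if (j < n)%N then c j else 0.
Proof.
move=> ns /andP[j1 js]; rewrite summxE.
under eq_big_nat => l /andP[_ ln].
  rewrite mxE symbolE //; last by rewrite -ltnS (leq_trans ln).
  rewrite mulr_natr mulrb.
  over.
by rewrite -big_mkcond big_nat1_eq j1.
Qed.

Section DeltaCoefficients.
Variables (R : realType) (s : nat) (A : nat -> R).

(** The step size is fixed at 1: the storage hypothesis holds for every [h], and this one value
    already exposes every coefficient. *)
Definition delta_coef (i j : nat) : R :=
  twoN_delta A 1 (symbol R s) i 0 (inord j).

(** The junk value 0 of [twoN_delta] at index 1 lets the recurrence start at [i = 1]: the term in
    [A 1] vanishes and only [k_1] remains. *)
Lemma delta_coef_rec (i j : nat) : (1 <= i <= s)%N -> (j <= s)%N ->
  delta_coef i.+1 j = A i * delta_coef i j + (i == j)%:R.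
Proof.
case: i => [//|[|i]] /= is_ js; rewrite /delta_coef /= !mxE ?mul1r.
  by rewrite -(symbolE R _ _ _ is_ js) mxE mulr0 add0r.
by rewrite -(symbolE R _ _ _ is_ js) !mxE.
Qed.

Lemma delta_coef_small (i j : nat) : (1 <= i <= j)%N -> (j <= s)%N ->
  delta_coef i j = 0.
Proof.
move=> + js; elim: i => [//|[_ _|i IH /andP[_ ij]]].
  by rewrite /delta_coef /= mxE.
rewrite delta_coef_rec // ?(leq_trans (ltnW ij)) //.
by rewrite IH ?(ltnW ij) // mulr0 add0r (ltn_eqF ij).
Qed.

Lemma delta_coef_diag (j : nat) : (1 <= j <= s)%N -> delta_coef j.+1 j = 1.
Proof.
move=> /[dup] /andP[j1 js] hj.
by rewrite delta_coef_rec // delta_coef_small ?j1 ?leqnn // mulr0 add0r eqxx.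
Qed.

(** The coefficient is 1 at [i = j + 1], and each later step multiplies it by some [A l] with
    [l >= j + 1 >= 2], so [A 1], which is zero in a 2N-storage method, never enters. *)
Lemma delta_coef_neq0 (i j : nat) :
  (forall l : nat, (2 <= l <= s)%N -> A l != 0) ->
  (1 <= j)%N -> (j < i <= s.+1)%N -> delta_coef i j != 0.
Proof.
move=> hA j1; elim: i => [//|i IH] /andP[]; rewrite ltnS leq_eqVlt.
case: eqP => [<- _ js|_ /= ji is_].
  by rewrite delta_coef_diag ?oner_eq0 // j1.
have i2 : (1 < i)%N by apply: leq_trans ji.
rewrite delta_coef_rec ?(ltnW i2) //; last by rewrite ltnW // (leq_trans ji).
by rewrite (gtn_eqF ji) addr0 mulf_neq0 ?hA ?i2 // IH // ji ltnW.
Qed.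

(** From index [j + 2] on, the Kronecker terms vanish and columns [j] and [j + 1] obey the same
    homogeneous recurrence. Their values at [j + 2] are [A j.+1] and 1, and this proportion
    propagates. *)
Lemma delta_coefS (i j : nat) : (1 <= j)%N -> (j.+2 <= i <= s.+1)%N ->
  delta_coef i j = A j.+1 * delta_coef i j.+1.
Proof.
move=> j1; elim: i => [//|i IH] /andP[]; rewrite ltnS leq_eqVlt.
case: eqP => [<- _ js|_ /= ji is_].
  have js' : (j <= s)%N by apply: ltnW.
  rewrite delta_coef_diag // delta_coef_rec //.
  by rewrite delta_coef_diag ?j1 // (gtn_eqF (ltnSn j)) addr0 mulr1.
have i1 : (1 <= i)%N by apply: leq_trans ji.
have js : (j.+1 <= s)%N by rewrite ltnW // (leq_trans ji).
rewrite !delta_coef_rec ?i1 ?(ltnW js) // IH ?ji ?(ltnW is_) //.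
by rewrite (gtn_eqF ji) (gtn_eqF (ltnW ji)) !addr0 mulrCA.
Qed.

End DeltaCoefficients.

Section StageCoefficients.
Variables (R : realType) (s : nat) (m : explicit_rk R s) (A B : nat -> R).
Hypothesis hm : is_twoN_storage m A B.

Lemma coord_rk_stage (i j : nat) : (1 <= i <= s.+1)%N -> (1 <= j <= s)%N ->
  rk_stage m 1 (symbol R s 0) (symbol R s) i 0 (inord j)
  = if i == s.+1 then rk_b m j else rk_a m i j.
Proof.
move=> /andP[i1 is_] /[dup] hj /andP[j1 js]; rewrite /rk_stage.
case: ifP => _; rewrite scale1r mxE symbolE // (ltn_eqF j1) add0r.
  by rewrite coord_sum_symbol // ltnS js.
(* For [j >= i] the sum has no term in [k_j], which agrees with [a_ij = 0] by explicitness. *)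
rewrite coord_sum_symbol //; case: ltnP => // ij.
by rewrite rk_explicit.
Qed.

(** The conditional treats the final update as stage [s + 1], so that [alpha] ([i < s]) and [beta]
    ([i = s]) are covered at once. *)
Lemma coord_stage_diff (i j : nat) : (1 <= i <= s)%N -> (1 <= j <= s)%N ->
  (if i.+1 == s.+1 then rk_b m j else rk_a m i.+1 j) - rk_a m i j
  = B i * delta_coef R s A i.+1 j.
Proof.
move=> /andP[i1 is_] hj; case: hm => _ _ st.
have i1s : (1 <= i.+1 <= s.+1)%N by [].
have is1 : (1 <= i <= s.+1)%N by rewrite i1 ltnW.
have <- := coord_rk_stage _ _ i1s hj.
have := coord_rk_stage _ _ is1 hj; rewrite (ltn_eqF (_ : i < s.+1)%N) // => <-.
(* The recursion of [twoN_stage] begins at index 2, so [i] must be exposed as a successor before the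
   stage unfolds by conversion. *)
rewrite !st //; case: i i1 {is_ i1s is1} => [//|i] _.
set y0 := symbol R s 0.
have -> : twoN_stage A B 1 y0 (symbol R s) i.+2
    = twoN_stage A B 1 y0 (symbol R s) i.+1
      + B i.+1 *: twoN_delta A 1 (symbol R s) i.+2 by [].
by rewrite mxE addrAC subrr add0r mxE.
Qed.

Lemma rk_alphaE (i j : nat) : (2 <= i <= s)%N -> (1 <= j <= s)%N ->
  rk_alpha m i j = B i.-1 * delta_coef R s A i j.
Proof.
case: i => [//|i] /andP[i1 is_] hj.
by rewrite -coord_stage_diff ?(ltnW is_) ?andbT // eqSS (ltn_eqF is_).
Qed.

Lemma rk_betaE (j : nat) : (1 <= j <= s)%N ->
  rk_beta m j = B s * delta_coef R s A s.+1 j.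
Proof.
move=> /[dup] hj /andP[j1 js].
by rewrite -coord_stage_diff ?eqxx // (leq_trans j1 js) leqnn.
Qed.

End StageCoefficients.

Theorem theorem1 (R : realType) (s : nat) (hs : (1 <= s)%N)
    (m : explicit_rk R s) (A B : nat -> R)
    (hm : is_twoN_storage m A B)
    (hA : forall i : nat, (2 <= i <= s)%N -> A i != 0) :
  forall j : nat, (1 <= j)%N -> (j + 2 <= s)%N ->
    rk_beta m (j + 1) != 0 /\
    (forall i : nat, (j + 2 <= i <= s)%N ->
       rk_alpha m i (j + 1) != 0 /\
       rk_alpha m i j / rk_alpha m i (j + 1)
       = rk_beta m j / rk_beta m (j + 1)).
Proof.
move=> j j1; rewrite addn1 addn2 => js.
have [_ hB _] := hm.
have hj : (1 <= j <= s)%N by rewrite j1 (ltnW (ltnW js)).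
have hj1 : (1 <= j.+1 <= s)%N by rewrite (ltnW js).
have D0 i : (j.+2 <= i <= s.+1)%N -> delta_coef R s A i j.+1 != 0.
  exact: delta_coef_neq0.
(* Here [b] stands for [B i.-1] in the [alpha] ratios and for [B s], with [i = s + 1], in the [beta]
   ratio; it cancels. *)
have ratio i b : (j.+2 <= i <= s.+1)%N -> b != 0 ->
    b * delta_coef R s A i j / (b * delta_coef R s A i j.+1) = A j.+1.
  by move=> hi b0; rewrite -mulf_div divff // mul1r delta_coefS // mulfK // D0.
have hs1 : (j.+2 <= s.+1 <= s.+1)%N by rewrite leqnn andbT ltnW.
have Bs : B s != 0 by rewrite hB // hs leqnn.
rewrite !(rk_betaE _ _ _ _ _ hm) //; split; first by rewrite mulf_neq0 // D0.
move=> i /andP[ji is_].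
have hi : (2 <= i <= s)%N by rewrite is_ andbT (leq_trans _ ji).
have hi1 : (j.+2 <= i <= s.+1)%N by rewrite ji ltnW.
have Bi : B i.-1 != 0.
  by apply: hB; case: i hi {ji is_ hi1} => [//|i] /andP[i1 /ltnW ->]; rewrite andbT.
rewrite !(rk_alphaE _ _ _ _ _ hm) //; split; first by rewrite mulf_neq0 // D0.
by rewrite !ratio.
Qed.
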